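(* Let $K$ be a field and let $I\subseteq K[x_1,\ldots,x_n]$ be a nonzero proper square-free monomial ideal which satisfies the packing property. Then $SP(I)=NP(I)$, i.e. the symbolic polyhedron of $I$ equals the Newton polyhedron of $I$.
   Context: A square-free monomial ideal of $K[x_1,\ldots,x_n]$ is an ideal generated by square-free monomials; it has a unique irredundant decomposition $I=P_1\cap\cdots\cap P_s$ with each $P_j$ a prime ideal generated by a subset of the variables. Its height $\mathrm{ht}(I)$ is the minimum over $j$ of the number of variables generating $P_j$. A square-free monomial ideal $I$ is König if there is a set of pairwise coprime monomials in $I$ of cardinality $\mathrm{ht}(I)$. The ideal $I$ has the packing property if every ideal obtained from $I$ by setting a (possibly empty) subset of the variables equal to $0$ and a disjoint (possibly empty) subset of the variables equal to $1$ is König. (Convention: the zero ideal and the unit ideal, which may arise this way, are regarded as König.) The Newton polyhedron is $NP(I)=$ the convex hull in $\mathbb{R}^n$ of $\{(a_1,\ldots,a_n)\in\mathbb{N}^n : x_1^{a_1}\cdots x_n^{a_n}\in I\}$, where $\mathbb{N}=\{0,1,2,\ldots\}$. The symbolic polyhedron is $SP(I)=NP(P_1)\cap\cdots\cap NP(P_s)$; equivalently, $SP(I)$ is the set of $\mathbf{y}\in\mathbb{R}^n$ with $y_i\ge 0$ for all $i$ and $\sum_{i: x_i\in P_j} y_i\geq 1$ for all $j=1,\ldots,s$. *)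

(* Defs.v *)
From HB Require Import structures.
From mathcomp Require Import all_boot all_order all_algebra.
From mathcomp Require Import mpoly.
From mathcomp Require Import boolp classical_sets reals convex.

Set Implicit Arguments.
Unset Strict Implicit.
Unset Printing Implicit Defensive.

Import Order.TTheory GRing.Theory Num.Theory.

Local Open Scope classical_set_scope.
Local Open Scope ring_scope.

Record is_ideal (A : comNzRingType) (J : set A) : Prop := IsIdeal {
  ideal0 : J 0;
  idealD : forall f g, J f -> J g -> J (f + g);
  idealM : forall a f, J f -> J (a * f)
}.

Definition ideal_gen (A : comNzRingType) (S : set A) : set A :=
  smallest (@is_ideal A) S.

Definition squarefree_mnm (n : nat) (m : 'X_{1..n}) : Prop :=
  forall i, (m i <= 1)%N.

Definition coprime_mnm (n : nat) (m m' : 'X_{1..n}) : Prop :=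
  forall i, m i = 0%N \/ m' i = 0%N.

Definition mnm_ideal (K : fieldType) (n : nat) (S : set 'X_{1..n}) :
    set {mpoly K[n]} :=
  ideal_gen [set 'X_[m] | m in S].
Arguments mnm_ideal K {n} S.

Definition squarefree_monomial_ideal (K : fieldType) (n : nat)
    (I : set {mpoly K[n]}) : Prop :=
  exists2 S : set 'X_{1..n}, S `<=` @squarefree_mnm n & I = mnm_ideal K S.

Definition var_ideal (K : fieldType) (n : nat) (A : {set 'I_n}) :
    set {mpoly K[n]} :=
  ideal_gen [set 'X_i | i in [set` A]].
Arguments var_ideal K {n} A.

(* The empty intersection is the whole ring, so the unit ideal has the empty
   decomposition; the zero ideal is its own prime component, with no variable. *)
Definition irredundant_decomposition (K : fieldType) (n : nat)
    (I : set {mpoly K[n]}) (D : {set {set 'I_n}}) : Prop :=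
  I = \bigcap_(A in [set` D]) var_ideal K A /\
  forall A, A \in D ->
    \bigcap_(B in [set` (D :\ A)%SET]) var_ideal K B <> I.

(* Each prime P_j is represented by its set of variables. The choice is
   well-defined for square-free monomial ideals: see [prime_componentsP] and
   [irredundant_decomposition_unique] below. *)
Definition prime_components (K : fieldType) (n : nat) (I : set {mpoly K[n]}) :
    {set {set 'I_n}} :=
  xget finset.set0 [set D | irredundant_decomposition I D].

(* The neutral element n bounds every #|A|, so it only matters for the unit
   ideal, which has no component. *)
Definition height (K : fieldType) (n : nat) (I : set {mpoly K[n]}) : nat :=
  \big[minn/n]_(A in prime_components I) #|A|.

Definition konig (K : fieldType) (n : nat) (I : set {mpoly K[n]}) : Prop :=
  [\/ I = [set 0], I = setT |
   exists s : seq 'X_{1..n},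
     [/\ uniq s, size s = height I, {in s, forall m, I 'X_[m]} &
         {in s &, forall m m', m != m' -> coprime_mnm m m'}]].

(* The result is viewed as an ideal of the same polynomial ring: the ideal
   generated by the image of I under the substitution. *)
Definition specialize (K : fieldType) (n : nat) (V0 V1 : {set 'I_n})
    (I : set {mpoly K[n]}) : set {mpoly K[n]} :=
  ideal_gen
    [set f \mPo [tuple if i \in V0 then 0 else if i \in V1 then 1 else 'X_i
                | i < n] | f in I].

Definition packing_property (K : fieldType) (n : nat) (I : set {mpoly K[n]}) :
    Prop :=
  forall V0 V1 : {set 'I_n}, [disjoint V0 & V1]%B -> konig (specialize V0 V1 I).

Definition convex_hull (R : realType) (n : nat) (S : set 'rV[R]_n) :
    set 'rV[R]_n :=
  smallest (@convex_set R 'rV[R]_n) S.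

Definition newton_polyhedron (R : realType) (K : fieldType) (n : nat)
    (I : set {mpoly K[n]}) : set 'rV[R]_n :=
  convex_hull [set \row_i (m i)%:R | m in [set m : 'X_{1..n} | I 'X_[m]]].
Arguments newton_polyhedron R {K n} I.

Definition symbolic_polyhedron (R : realType) (K : fieldType) (n : nat)
    (I : set {mpoly K[n]}) : set 'rV[R]_n :=
  \bigcap_(A in [set` prime_components I]) newton_polyhedron R (var_ideal K A).
Arguments symbolic_polyhedron R {K n} I.

Lemma ideal_gen_ideal (A : comNzRingType) (S : set A) :
  is_ideal (ideal_gen S).
Proof.
split=> [J [Ji _]|f g If Ig J JS|a f If J JS]; first exact: ideal0 Ji.
- by apply: (idealD JS.1); [apply: If | apply: Ig].
- by apply: (idealM JS.1); apply: If.
Qed.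

Lemma mnm_idealP (K : fieldType) (n : nat) (S : set 'X_{1..n})
    (f : {mpoly K[n]}) :
  mnm_ideal K S f <->
  (forall m, m \in msupp f -> exists2 s, S s & (s <= m)%MM).
Proof.
split=> [|Hf].
  suff H : mnm_ideal K S `<=`
    [set g | forall m, m \in msupp g -> exists2 s, S s & (s <= m)%MM].
    exact: H.
  apply: smallest_sub => [|_ [s Ss <-] m /=]; last first.
    by rewrite msuppX inE => /eqP->; exists s => //; apply: lepm_refl.
  split=> [m|g h Hg Hh m|a g Hg m] /=; first by rewrite msupp0.
  - by move=> /msuppD_le; rewrite mem_cat => /orP[/Hg|/Hh].
  - move=> /msuppM_le /allpairsP[[m1 m2] [_ /= /Hg [s Ss le_s] ->]].
    exists s => //; apply/mnm_lepP => i; rewrite mnmDE.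
    by rewrite (leq_trans (elimT mnm_lepP le_s i)) ?leq_addl.
have Ji := ideal_gen_ideal [set ('X_[m] : {mpoly K[n]}) | m in S].
rewrite (mpolyE f) big_seq.
apply: (big_ind (mnm_ideal K S)) => [|g h Ig Ih|m /Hf [s Ss le_s]].
- exact: (ideal0 Ji).
- exact: (idealD Ji Ig Ih).
rewrite -(submK le_s) mpolyXD -mul_mpolyC mulrA.
by apply: (idealM Ji); apply: sub_gen_smallest; exists s.
Qed.

Lemma var_idealP (K : fieldType) (n : nat) (A : {set 'I_n})
    (f : {mpoly K[n]}) :
  var_ideal K A f <->
  (forall m, m \in msupp f -> exists2 i, i \in A & (0 < m i)%N).
Proof.
have -> : var_ideal K A = mnm_ideal K [set U_(i)%MM | i in [set` A]].
  rewrite /var_ideal /mnm_ideal; congr ideal_gen.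
  apply/seteqP; split=> [_ [i Ai <-]|_ [_ [i Ai <-] <-]]; last by exists i.
  by exists U_(i)%MM => //; exists i.
rewrite mnm_idealP; split=> Hf m /Hf.
  move=> [_ [i Ai <-] /mnm_lepP/(_ i)]; rewrite mnm1E eqxx; by exists i.
move=> [i Ai mi]; exists U_(i)%MM; first by exists i.
by apply/mnm_lepP => j; rewrite mnm1E; case: eqP => // <-.
Qed.

Lemma var_ideal_setC (K : fieldType) (n : nat) (A B : {set 'I_n}) :
  var_ideal K B ('X_[[multinom (i \notin A : nat) | i < n]]) <->
  ~ (B \subset A).
Proof.
rewrite var_idealP msuppX; split=> [|/negP/fintype.subsetPn [i Bi Ai] m].
  move=> /(_ _ (mem_head _ _)) [i Bi]; rewrite mnmE lt0b => Ai /fintype.subsetP.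
  by move=> /(_ i Bi); apply/negP.
by rewrite inE => /eqP->; exists i; rewrite // mnmE Ai.
Qed.

Lemma sub_var_ideal (K : fieldType) (n : nat) (A B : {set 'I_n}) :
  A \subset B -> var_ideal K A `<=` var_ideal K B.
Proof.
move=> /fintype.subsetP AB f /var_idealP Hf; apply/var_idealP => m /Hf [i /AB Bi mi].
by exists i.
Qed.

Lemma irredundant_decomposition_exists (K : fieldType) (n : nat)
    (I : set {mpoly K[n]}) :
  squarefree_monomial_ideal I -> exists D, irredundant_decomposition I D.
Proof.
move=> [S Ssqf ->].
pose cover (A : {set 'I_n}) :=
  `[< forall s, S s -> exists2 i, i \in A & (0 < s i)%N >].
have IP A : cover A -> mnm_ideal K S `<=` var_ideal K A.
  move=> /asboolP cA f /mnm_idealP Hf; apply/var_idealP => m /Hf [s Ss le_s].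
  have [i Ai si] := cA s Ss; exists i => //.
  by apply: leq_trans si _; exact: (elimT mnm_lepP le_s).
exists [set A | minset cover A]%SET; split=> [|A].
  apply/seteqP; split=> [f If A /=|f Hf].
    by rewrite inE => /minsetp cA; exact: IP If.
  apply/mnm_idealP => m mf; apply: contrapT => Hm.
  have /minset_exists [B minB sBA] : cover [set i | m i == 0%N]%SET.
    apply/asboolP => s Ss; apply: contrapT => Hs; apply: Hm; exists s => //.
    apply/mnm_lepP => i; rewrite leqNgt; apply/negP => lt_ms.
    apply: Hs; exists i; last exact: leq_ltn_trans lt_ms.
    rewrite inE -leqn0 -ltnS; exact: leq_trans lt_ms (Ssqf _ Ss i).
  have /var_idealP/(_ m mf) [i /(fintype.subsetP sBA)] : var_ideal K B f.
    by apply: Hf; rewrite /= inE.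
  by rewrite inE => /eqP->.
rewrite inE => minA eqI.
have: var_ideal K A ('X_[[multinom (i \notin A : nat) | i < n]]).
  apply: (IP A (minsetp minA)); rewrite -eqI => B /=.
  rewrite !inE => /andP[neqBA minB]; apply/var_ideal_setC => sBA.
  by move/eqP: neqBA; apply; apply: (minsetinf minA (minsetp minB) sBA).
by move/var_ideal_setC; apply.
Qed.

Lemma irredundant_decomposition_unique (K : fieldType) (n : nat)
    (I : set {mpoly K[n]}) (D D' : {set {set 'I_n}}) :
  irredundant_decomposition I D -> irredundant_decomposition I D' -> D = D'.
Proof.
have sub (E E' : {set {set 'I_n}}) A : I = \bigcap_(B in [set` E]) var_ideal K B ->
    I = \bigcap_(B in [set` E']) var_ideal K B -> A \in E ->
    exists2 B, B \in E' & B \subset A.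
  move=> IE IE' EA; apply: contrapT => H.
  have : I 'X_[[multinom (i \notin A : nat) | i < n]].
    by rewrite IE' => B E'B; apply/var_ideal_setC => sBA; apply: H; exists B.
  by rewrite IE => /(_ A EA) /var_ideal_setC; apply.
have incl (E E' : {set {set 'I_n}}) : irredundant_decomposition I E ->
    irredundant_decomposition I E' -> E \subset E'.
  move=> [IE irrE] [IE' _]; apply/fintype.subsetP => A EA.
  have [B E'B sBA] := sub _ _ _ IE IE' EA.
  have [C EC sCB] := sub _ _ _ IE' IE E'B.
  have [eqCA|neqCA] := eqVneq C A.
    by rewrite (_ : A = B) //; apply/eqP; rewrite finset.eqEsubset -{1}eqCA sCB.
  exfalso; apply: (irrE A EA); rewrite [RHS]IE; apply/seteqP; split=> f Hf F.
    move=> /= EF; have [->|neqFA] := eqVneq F A; last by apply: Hf; rewrite /= !inE neqFA.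
    apply: (sub_var_ideal (fintype.subset_trans sCB sBA)).
    by apply: Hf; rewrite /= !inE neqCA.
  by rewrite /= !inE => /andP[_]; apply: Hf.
by move=> dD dD'; apply/eqP; rewrite finset.eqEsubset !incl.
Qed.

Lemma prime_componentsP (K : fieldType) (n : nat) (I : set {mpoly K[n]}) :
  squarefree_monomial_ideal I ->
  irredundant_decomposition I (prime_components I).
Proof.
move=> /irredundant_decomposition_exists [D dD].
exact: (xgetPex finset.set0 (ex_intro _ D dD)).
Qed.

(* Main.v *)
Require Import Defs.
From HB Require Import structures.
From mathcomp Require Import all_boot all_order all_algebra.
From mathcomp Require Import perm.
From mathcomp Require Import ring lra zify.

(** The supports of the monomials of [I] form an up-closed family [G] of sets of
    variables, and the packing property makes every minor of [G] König. By Farkas'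
    lemma, [SP(I) = NP(I)] follows once every [x >= 0] with mass at least 1 on each
    member of [G] dominates a convex combination of sets hitting all of [G]. This is
    Lehman's theorem on minimally non-ideal clutters, specialised to König families.
    By induction on the number [m] of variables it is enough to treat a vertex [x]
    with all coordinates in [(0, 1)], given by [m] linearly independent tight members
    [E_e]. Deleting the variable [i] gives hitting sets that meet every tight member
    avoiding [i] exactly once, whence [|E_e| <= d_i] for [i] not in [E_e], where [d_i]
    is the number of tight members containing [i]; double counting turns this into an
    equality. The König property gives a hitting set [P] with at most [x(V)] elements,
    and the equalities force [P] to meet each [E_e] exactly once, so that [x] is the
    0/1 indicator of [P], a contradiction. *)

Set Implicit Arguments.
Unset Strict Implicit.
Unset Printing Implicit Defensive.

Import Order.TTheory GRing.Theory Num.Theory.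

Local Open Scope ring_scope.

(** * Linear inequalities *)

(** Induction on the rows. If the vector found for [A'] violates the new row [a], projecting along
    it turns [A'] and [b] into rows vanishing on it, and the induction hypothesis applies again. *)
Lemma farkas (F : realFieldType) k n (A : 'M[F]_(k, n)) (b : 'rV[F]_n) :
  (exists2 l : 'rV[F]_k, forall j, 0 <= l 0 j & l *m A = b) \/
  (exists2 x : 'cV[F]_n, forall j, (A *m x) j 0 <= 0 & 0 < (b *m x) 0 0).
Proof.
elim: k A b => [|k IH]; last change k.+1 with (1 + k)%N; move=> A b.
  have [->|/rV0Pn[i bi0]] := eqVneq b 0.
    by left; exists 0; [case | rewrite mul0mx].
  right; exists b^T; first by case.
  have sq_ge0 j : true -> 0 <= b 0 j * b^T j 0 by rewrite mxE -expr2 sqr_ge0.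
  rewrite mxE lt_neqAle sumr_ge0 // eq_sym andbT psumr_neq0 //.
  apply/hasP; exists i; first exact: mem_index_enum.
  by rewrite /= mxE -expr2 exprn_even_gt0.
rewrite -[A]vsubmxK; set a := usubmx A; set A' := dsubmx A.
have col_le0 (x : 'cV_n) :
    (a *m x) 0 0 <= 0 -> (forall j, (A' *m x) j 0 <= 0) ->
    forall j : 'I_(1 + k), (col_mx a A' *m x) j 0 <= 0.
  move=> ax A'x j; rewrite mul_col_mx.
  by case: (split_ordP j) => j' ->; rewrite ?col_mxEu ?col_mxEd // ord1.
have [[l l_ge0 lA]|[x0 A'x0 bx0]] := IH A' b.
  left; exists (row_mx (0 : 'rV_1) l); last by rewrite mul_row_col mul0mx add0r.
  by move=> j; case: (split_ordP j) => j' ->; rewrite ?row_mxEl ?row_mxEr // mxE.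
have [ax0|ax0] := lerP ((a *m x0) 0 0) 0.
  by right; exists x0 => //; exact: col_le0.
(* [x0] only violates the row [a]: eliminate [a] by projecting along [x0]. *)
set t := (a *m x0) 0 0 in ax0.
pose proj k' (B : 'M[F]_(k', n)) := B - t^-1 *: (B *m x0 *m a).
have projE k' (B : 'M[F]_(k', n)) x :
    proj k' B *m x = B *m (x - t^-1 *: (x0 *m (a *m x))).
  by rewrite mulmxBl mulmxBr -scalemxAl -scalemxAr !mulmxA.
have [[l l_ge0 lA]|[x A'x bx]] := IH (proj _ A') (proj _ b).
  (* The coefficient of [a] is read off from [lA]; it is nonnegative since [b *m x0] is positive
     while [A' *m x0] has entries at most 0. *)
  left; exists (row_mx (t^-1 *: (b *m x0 - l *m A' *m x0)) l).
    move=> j; case: (split_ordP j) => j' ->; last by rewrite row_mxEr.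
    rewrite row_mxEl ord1 mxE.
    apply: mulr_ge0; first by rewrite invr_ge0 ltW.
    rewrite mxE [X in _ + X]mxE subr_ge0 (le_trans _ (ltW bx0)) //.
    rewrite -mulmxA mxE sumr_le0 // => i _; exact: mulr_ge0_le0.
  rewrite mul_row_col -scalemxAl mulmxBl scalerBr.
  move: lA; rewrite /proj mulmxBr -scalemxAr !mulmxA.
  set Z := l *m A' *m x0 *m a; set W := b *m x0 *m a => /eqP.
  rewrite subr_eq => /eqP ->; move: Z W => Z W.
  by apply/matrixP => i j; rewrite !mxE; ring.
right; exists (x - t^-1 *: (x0 *m (a *m x))); last by rewrite -projE.
apply: col_le0 => [|j]; last by rewrite -projE.
rewrite mulmxBr -scalemxAr (mulmxA a x0) [a *m x0]mx11_scalar [a *m x]mx11_scalar.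
rewrite -scalar_mxM -/t !mxE eqxx !mulr1n mulrA mulVf ?mul1r ?subrr //.
by rewrite gt_eqF.
Qed.

(** Some term of the Leibniz expansion of the determinant is nonzero, and its permutation must send
    [X] injectively outside [Y]. *)
Lemma unitmx_zero_block (F : fieldType) m (U : 'M[F]_m) (X Y : {set 'I_m}) :
  U \in unitmx -> (forall r c, r \in X -> c \in Y -> U r c = 0) ->
  (#|X| + #|Y| <= m)%N.
Proof.
move=> Uunit U0.
have [s Us] : exists s : 'S_m, \prod_i U i (s i) != 0.
  apply/existsP; apply: contraLR Uunit; rewrite negb_exists => /forallP U0s.
  rewrite unitmxE unitfE /determinant big1 ?eqxx // => s _.
  by move/negPn/eqP: (U0s s) => ->; rewrite mulr0.
have sXY : s @: X \subset ~: Y.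
  apply/subsetP => _ /imsetP[r rX ->]; rewrite inE; apply/negP => srY.
  by move/prodf_neq0: Us => /(_ r isT); rewrite U0 ?eqxx.
have := subset_leq_card sXY; rewrite card_imset; last exact: perm_inj.
have := cardsC Y; rewrite card_ord => eqm leXY.
by rewrite -[leqRHS]eqm addnC leq_add2l.
Qed.

(** Ratio test: [s] is the least [u k / - v k] over the [k] with [v k < 0]. It is positive because
    [v] vanishes wherever [u] does. *)
Lemma first_zero (F : realFieldType) (K : finType) (u v : K -> F) :
  (forall k, 0 <= u k) -> (forall k, u k = 0 -> v k = 0) ->
  (exists k, v k < 0) ->
  exists s, [/\ 0 < s, forall k, 0 <= u k + s * v k &
                exists2 k, u k != 0 & u k + s * v k = 0].
Proof.
move=> u_ge0 u0 [k0 vk0].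
have [k vk min_k] :=
  @arg_minP _ _ _ k0 (fun k => v k < 0) (fun k => u k / - v k) vk0.
have uk : u k != 0 by apply: contraTneq vk => /u0 ->; rewrite ltxx.
have vk' : 0 < - v k by rewrite oppr_gt0.
exists (u k / - v k); split; first by rewrite divr_gt0 // lt0r uk u_ge0.
- move=> k'; have [vk'0|vk'0] := ltP (v k') 0; last first.
    by rewrite addr_ge0 // mulr_ge0 // divr_ge0 // ltW.
  have := min_k _ vk'0; rewrite ler_pdivlMr ?oppr_gt0 //; lra.
by exists k => //; rewrite invrN mulrN mulNr divfK ?subrr // lt_eqF.
Qed.

(** * Hitting sets and minors *)

Definition mass (F : nmodType) (T : finType) (x : T -> F) (E : {set T}) : F :=
  \sum_(i in E) x i.

Definition hits (T : finType) (G : {set {set T}}) (P : {set T}) :=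
  [forall E in G, E :&: P != set0].

Definition upclosed (T : finType) (G : {set {set T}}) : Prop :=
  forall E E' : {set T}, E \in G -> E \subset E' -> E' \in G.

Definition fractional_cover (F : numDomainType) (T : finType)
    (G : {set {set T}}) (x : T -> F) : Prop :=
  (forall i, 0 <= x i) /\ (forall E, E \in G -> 1 <= mass x E).

(** The bound is restricted to [D] because deleting a variable leaves its own coordinate
    uncontrolled. *)
Definition covers_below (F : numDomainType) (T : finType) (G : {set {set T}})
    (D : {set T}) (x : T -> F) : Prop :=
  exists (K : finType) (P : K -> {set T}) (l : K -> F),
    [/\ forall k, 0 <= l k, \sum_k l k = 1, forall k, hits G (P k) &
        forall i, i \in D -> \sum_(k | i \in P k) l k <= x i].

(** [P] stands for a prime component of least size and [S] for the supports of coprime monomials;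
    the reverse inequality is automatic. *)
Definition konig_family (T : finType) (G : {set {set T}}) : Prop :=
  exists (P : {set T}) (S : {set {set T}}),
    [/\ hits G P, S \subset G, trivIset S & (#|P| <= #|S|)%N].

(* Variables in [V] are set to 1, those outside [V] and the range of [f] are set
   to 0; for an up-closed family this is the usual clutter minor. *)
Definition minor (T T' : finType) (f : T' -> T) (V : {set T})
    (G : {set {set T}}) : {set {set T'}} :=
  [set E : {set T'} | f @: E :|: V \in G].

(** A minor containing the empty set corresponds to the unit ideal and has no hitting set, hence its
    exclusion. Ordinals as ground sets allow induction on the number of variables. *)
Definition packs (T : finType) (G : {set {set T}}) : Prop :=
  forall m (f : 'I_m -> T) (V : {set T}), injective f ->
    (forall i, f i \notin V) -> set0 \notin minor f V G ->
    konig_family (minor f V G).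

Definition incidence (F : pzSemiRingType) m (E : 'I_m -> {set 'I_m}) : 'M[F]_m :=
  \matrix_(e, i) (i \in E e)%:R.

Lemma hitsP (T : finType) (G : {set {set T}}) (P : {set T}) :
  reflect (forall E, E \in G -> exists2 i, i \in E & i \in P) (hits G P).
Proof.
apply: (iffP forall_inP) => hit E /hit.
  by case/set0Pn => i /setIP[]; exists i.
by case=> i iE iP; apply/set0Pn; exists i; rewrite inE iE.
Qed.

Lemma mass_axpy (F : pzSemiRingType) (T : finType) (x z : T -> F) (s : F) E :
  mass (fun i => x i + s * z i) E = mass x E + s * mass z E.
Proof. by rewrite /mass big_split /= mulr_sumr. Qed.

Lemma massUI (F : nmodType) (T : finType) (x : T -> F) (A B : {set T}) :
  mass x (A :|: B) + mass x (A :&: B) = mass x A + mass x B.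
Proof.
rewrite /mass ![\sum_(i in _) _]big_mkcond -!big_split /=.
apply: eq_bigr => i _; rewrite !inE.
by case: (i \in A); case: (i \in B); rewrite ?addr0 ?add0r.
Qed.

Lemma mass_gt0 (F : numDomainType) (T : finType) (x : T -> F) (A : {set T}) i :
  (forall j, 0 < x j) -> i \in A -> 0 < mass x A.
Proof.
move=> x_gt0 iA; rewrite /mass (bigD1 i) //= ltr_pwDl //.
by apply: sumr_ge0 => j _; apply: ltW.
Qed.

Lemma mass_mono (F : numDomainType) (T : finType) (x : T -> F) (A B : {set T}) :
  (forall j, 0 <= x j) -> A \subset B -> mass x A <= mass x B.
Proof.
move=> x_ge0 sAB; rewrite /mass [leRHS](big_setID A) /= (setIidPr sAB) lerDl.
by apply: sumr_ge0 => j _.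
Qed.

Lemma mass_imset (F : nmodType) (T T' : finType) (f : T' -> T) (x : T -> F)
    (A : {set T'}) :
  injective f -> mass x (f @: A) = mass (x \o f) A.
Proof. by move=> f_inj; rewrite /mass big_imset // => i j _ _ /f_inj. Qed.

Lemma upclosed_minor (T T' : finType) (f : T' -> T) (V : {set T}) G :
  upclosed G -> upclosed (minor f V G).
Proof.
move=> upG E E'; rewrite !inE => EG sEE'; apply: upG EG _.
by rewrite setSU // imsetS.
Qed.

Lemma minor_id (T : finType) (G : {set {set T}}) : minor id set0 G = G.
Proof. by apply/setP => E; rewrite inE imset_id setU0. Qed.

Lemma minor_minor (T1 T2 T3 : finType) (f : T2 -> T1) (g : T3 -> T2)
    (V : {set T1}) (W : {set T2}) G :
  minor g W (minor f V G) = minor (f \o g) (f @: W :|: V) G.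
Proof. by apply/setP => E; rewrite !inE imsetU imset_comp setUA. Qed.

Lemma packs_minor (T T' : finType) (f : T' -> T) (V : {set T}) G :
  injective f -> (forall i, f i \notin V) -> packs G -> packs (minor f V G).
Proof.
move=> f_inj fV pG m g W g_inj gW; rewrite minor_minor; apply: pG.
  exact: inj_comp.
move=> i; rewrite inE negb_or fV andbT.
by apply: contra (gW i) => /imsetP[j jW /f_inj ->].
Qed.

Lemma covers_below_conv (F : numDomainType) (T : finType) G (D : {set T})
    (x1 x2 x : T -> F) a b :
  covers_below G D x1 -> covers_below G D x2 -> 0 <= a -> 0 <= b -> a + b = 1 ->
  (forall i, i \in D -> a * x1 i + b * x2 i <= x i) -> covers_below G D x.
Proof.
move=> [K1 [P1 [l1 [l1_ge0 sum1 hit1 le1]]]].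
move=> [K2 [P2 [l2 [l2_ge0 sum2 hit2 le2]]]].
move=> a_ge0 b_ge0 ab1 lex.
exists (K1 + K2)%type,
  (fun k => match k with inl k => P1 k | inr k => P2 k end),
  (fun k => match k with inl k => a * l1 k | inr k => b * l2 k end); split.
- by case=> k; apply: mulr_ge0.
- by rewrite big_sumType /= -!mulr_sumr sum1 sum2 !mulr1.
- by case.
- move=> i iD; apply: le_trans (lex i iD).
  by rewrite big_sumType /= -!mulr_sumr lerD // ler_wpM2l ?le1 ?le2.
Qed.

(** Adding [i] to every hitting set of the deletion takes care of the members through [i] and
    affects no other coordinate. *)
Lemma covers_below_deletion (F : numDomainType) m (G : {set {set 'I_m.+1}}) i
    (x : 'I_m.+1 -> F) :
  (forall y : 'I_m -> F, fractional_cover (minor (lift i) set0 G) y ->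
     covers_below (minor (lift i) set0 G) setT y) ->
  fractional_cover G x -> covers_below G [set~ i] x.
Proof.
move=> ideal_del [x_ge0 x_ge1].
have [|K [P [l [l_ge0 suml hitP leP]]]] := ideal_del (x \o lift i).
  split=> [j|E]; first exact: x_ge0.
  rewrite inE setU0 => /x_ge1; rewrite mass_imset //; exact: lift_inj.
exists K, (fun k => i |: lift i @: P k), l; split=> // [k|j].
- apply/hitsP => E EG; have [iE|iE] := boolP (i \in E).
    by exists i; rewrite ?setU11.
  have defE : lift i @: (lift i @^-1: E) = E.
    apply/setP => j; apply/imsetP/idP => [[j' + ->]|jE]; first by rewrite inE.
    have : i != j by apply: contraNneq iE => ->.
    by case/unlift_some => j' defj _; exists j'; rewrite // inE -defj.
  have /(hitsP _ _ (hitP k))[j] : lift i @^-1: E \in minor (lift i) set0 G.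
    by rewrite inE setU0 defE.
  by rewrite inE => jE jP; exists (lift i j) => //; rewrite setU1r ?imset_f.
- rewrite !inE eq_sym => /unlift_some[j' -> _].
  apply: le_trans (leP j' (in_setT _)); rewrite le_eqVlt; apply/orP; left.
  apply/eqP/eq_bigl => k; rewrite !inE eq_sym (negPf (neq_lift _ _)) /=.
  by rewrite mem_imset //; exact: lift_inj.
Qed.

(** As [G] is up-closed, each member gives a member of the contraction once [i] is dropped, so
    hitting sets of the contraction hit [G] without using [i]. *)
Lemma covers_below_contraction (F : numDomainType) m (G : {set {set 'I_m.+1}}) i
    (x : 'I_m.+1 -> F) :
  (forall y : 'I_m -> F, fractional_cover (minor (lift i) [set i] G) y ->
     covers_below (minor (lift i) [set i] G) setT y) ->
  upclosed G -> fractional_cover G x -> x i = 0 -> covers_below G setT x.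
Proof.
move=> ideal_con upG [x_ge0 x_ge1] xi0.
have iN (A : {set 'I_m}) : i \notin lift i @: A.
  by apply/negP => /imsetP[j _ /eqP]; rewrite (negPf (neq_lift _ _)).
have [|K [P [l [l_ge0 suml hitP leP]]]] := ideal_con (x \o lift i).
  split=> [j|E]; first exact: x_ge0.
  rewrite inE => /x_ge1; rewrite setUC /mass big_setU1 //= xi0 add0r.
  by rewrite -/(mass _ _) mass_imset //; exact: lift_inj.
exists K, (fun k => lift i @: P k), l; split=> // [k|j _].
- apply/hitsP => E EG.
  have /(hitsP _ _ (hitP k))[j] : lift i @^-1: E \in minor (lift i) [set i] G.
    rewrite inE; apply: upG EG _; apply/subsetP => j jE; rewrite !inE.
    have [->|] := eqVneq j i; first by rewrite orbT.
    rewrite eq_sym => /unlift_some[j' defj _]; rewrite defj in jE *.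
    by rewrite imset_f // inE.
  by rewrite inE => jE jP; exists (lift i j) => //; rewrite imset_f.
- have [->|] := eqVneq j i.
    by rewrite big_pred0 // => k; apply/negbTE.
  rewrite eq_sym => /unlift_some[j' -> _].
  apply: le_trans (leP j' (in_setT _)); rewrite le_eqVlt; apply/orP; left.
  by apply/eqP/eq_bigl => k; rewrite mem_imset //; exact: lift_inj.
Qed.

(** Meant for the tight members at a point: the first case makes the point a vertex, the second
    gives a direction along which they all stay tight. *)
Lemma incidence_basis (F : fieldType) m (S : {set {set 'I_m}}) :
  (exists2 E : 'I_m -> {set 'I_m},
     forall e, E e \in S & incidence F E \in unitmx) \/
  (exists2 z : 'I_m -> F, exists i, z i != 0 &
     forall E, E \in S -> mass z E = 0).
Proof.
pose B : 'M[F]_(#|S|, m) := \matrix_(k, i) (i \in (enum_val k : {set 'I_m}))%:R.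
have [fullB|] := boolP (row_full B).
  left; exists (fun e => enum_val (fullrankfun fullB e)) => [e|].
    exact: enum_valP.
  rewrite (_ : incidence _ _ = rowsub (fullrankfun fullB) B) ?fullrowsub_unit //.
  by apply/matrixP => e i; rewrite !mxE.
rewrite /row_full -mxrank_tr -/(row_free _) -kermx_eq0 => /rowV0Pn[z].
move=> /sub_kermxP zB /rV0Pn[i zi]; right; exists (z 0); first by exists i.
move=> E ES; move/matrixP/(_ 0 (enum_rank_in ES E)): zB.
rewrite !mxE => zE0; rewrite -[RHS]zE0 /mass big_mkcond; apply: eq_bigr => j _.
by rewrite !mxE enum_rankK_in //; case: ifP; rewrite ?mulr1 ?mulr0.
Qed.

(** * Vertices of the fractional covering polyhedron *)

(** Slacks of members and coordinates form one family, to which [first_zero] applies. Tight members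
    stay tight and one more constraint becomes tight, so the count drops; it serves as induction
    measure below. *)
Lemma fractional_cover_move (F : realFieldType) (T : finType)
    (G : {set {set T}}) (x z : T -> F) :
  fractional_cover G x -> (forall i, 0 < x i) ->
  (forall E, E \in G -> mass x E = 1 -> mass z E = 0) -> (exists i, z i < 0) ->
  let nontight (y : T -> F) := [set E in G | mass y E != 1] in
  let support (y : T -> F) := [set i | y i != 0] in
  let moved s i := x i + s * z i in
  exists s, [/\ 0 < s, fractional_cover G (moved s) &
    (#|nontight (moved s)| + #|support (moved s)|
      < #|nontight x| + #|support x|)%N].
Proof.
move=> [x_ge0 x_ge1] x_gt0 z0 [i zi] nontight support moved.
pose u (k : {set T} + T) :=
  match k with inl E => if E \in G then mass x E - 1 else 0 | inr i => x i end.
pose v (k : {set T} + T) :=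
  match k with inl E => if E \in G then mass z E else 0 | inr i => z i end.
have [[E|j]|[E|j]||s [s_gt0 uv_ge0 [k uk uvk]]] := @first_zero _ _ u v.
- by rewrite /=; case: ifP => // /x_ge1; rewrite subr_ge0.
- exact: x_ge0.
- by rewrite /=; case: ifP => // EG /eqP; rewrite subr_eq0 => /eqP/(z0 _ EG).
- by move=> /= xj0; move: (x_gt0 j); rewrite xj0 ltxx.
- by exists (inr i).
exists s; set y := moved s.
have massy E : mass y E = mass x E + s * mass z E by exact: mass_axpy.
have sub_nontight : nontight y \subset nontight x.
  apply/subsetP => E; rewrite !inE => /andP[EG]; rewrite EG /=.
  by apply: contra => /eqP xE; rewrite massy (z0 E EG xE) xE mulr0 addr0.
have sub_support : support y \subset support x.
  by apply/subsetP => j _; rewrite inE gt_eqF.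
split=> //; first split=> [j|E EG]; first exact: (uv_ge0 (inr j)).
  by move: (uv_ge0 (inl E)); rewrite /= EG massy addrAC subr_ge0.
case: k uk uvk => [E|j] /=.
  case: ifP => [EG|]; last by rewrite eqxx.
  rewrite subr_eq0 => xE /eqP; rewrite addrAC subr_eq0 -massy => yE.
  rewrite -addSn leq_add ?subset_leq_card ?proper_card // properE sub_nontight.
  by apply/subsetPn; exists E; rewrite inE EG // yE.
move=> xj yj; rewrite -addnS leq_add ?subset_leq_card ?proper_card //.
rewrite properE sub_support; apply/subsetPn.
by exists j; rewrite inE // /y /moved yj eqxx.
Qed.

(** An interior point that is not a vertex can be moved both ways along a kernel direction until a
    new constraint is tight; it is a convex combination of the two endpoints, which are covered by
    induction. *)
Lemma covers_below_from_vertices (F : realFieldType) m (G : {set {set 'I_m}}) :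
  (forall x : 'I_m -> F, fractional_cover G x -> (exists i, x i = 0) ->
     covers_below G setT x) ->
  (forall (x : 'I_m -> F) (E : 'I_m -> {set 'I_m}), fractional_cover G x ->
     (forall i, 0 < x i) -> (forall e, E e \in G) ->
     (forall e, mass x (E e) = 1) ->
     incidence F E \in unitmx -> covers_below G setT x) ->
  forall x : 'I_m -> F, fractional_cover G x -> covers_below G setT x.
Proof.
move=> on_boundary on_vertex x.
have [k] :=
  ubnP (#|[set E in G | mass x E != 1%R]| + #|[set i | x i != 0%R]|)%N.
elim: k x => // k IH x; rewrite ltnS => lek xG.
have [/existsP[i /eqP xi]|] := boolP [exists i, x i == 0].
  by apply: on_boundary => //; exists i.
rewrite negb_exists => /forallP x_neq0.
have x_gt0 i : 0 < x i by rewrite lt0r x_neq0 xG.1.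
have [[E tightE unitE]|[z [i zi] z0]] :=
  @incidence_basis F m [set E in G | mass x E == 1].
  apply: (on_vertex x E) => // e; have := tightE e; rewrite inE.
    by case/andP.
  by case/andP => _ /eqP.
have step (z' : 'I_m -> F) :
    (forall E, E \in G -> mass x E = 1 -> mass z' E = 0) -> (exists i, z' i < 0) ->
    exists2 s, 0 < s & covers_below G setT (fun i => x i + s * z' i).
  move=> z'0 z'i.
  have [s [s_gt0 xs lts]] := fractional_cover_move xG x_gt0 z'0 z'i.
  by exists s => //; apply: IH => //; exact: leq_trans lts lek.
(* Up to changing the sign of [z], some coordinate decreases along it, so the move has to stop. *)
have {z i zi z0} [z z0 [i zi]] : exists2 z : 'I_m -> F,
    forall E, E \in G -> mass x E = 1 -> mass z E = 0 & exists i, z i < 0.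
  have {}z0 E : E \in G -> mass x E = 1 -> mass z E = 0.
    by move=> EG xE; apply: z0; rewrite inE EG xE eqxx.
  have [zi0|zi0|zi0] := ltgtP (z i) 0; last by rewrite zi0 eqxx in zi.
    by exists z => //; exists i.
  exists (fun j => - z j); last by exists i; rewrite oppr_lt0.
  by move=> E EG xE; rewrite /mass sumrN -/(mass z E) z0 ?oppr0.
have [s s_gt0 xs] := step z z0 (ex_intro _ i zi).
(* If [z <= 0], the opposite move may never stop, but the endpoint already found lies below [x]. *)
have [/existsP[j zj]|] := boolP [exists j, 0 < z j]; last first.
  rewrite negb_exists => /forallP z_le0.
  apply: (covers_below_conv xs xs ler01 (lexx 0) (addr0 1)) => j _.
  rewrite mul1r mul0r addr0 gerDl mulr_ge0_le0 ?(ltW s_gt0) //.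
  by rewrite leNgt z_le0.
have [||t t_gt0 xt] := step (fun j => - z j).
- by move=> E EG xE; rewrite /mass sumrN -/(mass z E) z0 ?oppr0.
- by exists j; rewrite oppr_lt0.
have st_gt0 : 0 < s + t by rewrite addr_gt0.
apply: (covers_below_conv (a := t / (s + t)) (b := s / (s + t)) xs xt).
- by rewrite divr_ge0 ?ltW.
- by rewrite divr_ge0 ?ltW.
- by rewrite -mulrDl addrC divff ?gt_eqF.
- move=> l _; rewrite le_eqVlt; apply/orP; left; apply/eqP.
  by field; rewrite gt_eqF.
Qed.

(** * Lehman's counting argument at a vertex *)

Lemma sum_indicI (F : pzSemiRingType) (T : finType) (A B : {set T}) :
  \sum_i (i \in A)%:R * (i \in B)%:R = #|A :&: B|%:R :> F.
Proof.
rewrite -sum1_card natr_sum [RHS]big_mkcond; apply: eq_bigr => i _.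
by rewrite inE -natrM mulnb; case: (_ && _).
Qed.

(** Complementary slackness: the sum of the [l k * #|E :&: P k|] is at least 1, since every [P k]
    meets [E], and at most [mass x E = 1], so all the inequalities involved are equalities. *)
Lemma covers_below_tight (F : realFieldType) (T : finType) (x : T -> F)
    (E : {set T}) (K : finType) (P : K -> {set T}) (l : K -> F) :
  (forall k, 0 <= l k) -> \sum_k l k = 1 -> (forall k, E :&: P k != set0) ->
  (forall i, i \in E -> \sum_(k | i \in P k) l k <= x i) -> mass x E = 1 ->
  (forall k, l k != 0 -> #|E :&: P k| = 1%N) /\
  (forall i, i \in E -> x i != 0 -> exists2 k, l k != 0 & i \in P k).
Proof.
move=> l_ge0 suml hitP leP xE.
have exch :
    \sum_(i in E) \sum_(k | i \in P k) l k = \sum_k l k * #|E :&: P k|%:R.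
  rewrite (exchange_big_dep predT) //=; apply: eq_bigr => k _.
  rewrite -sum1_card natr_sum mulr_sumr; apply: eq_big => [i|i _].
    by rewrite inE.
  by rewrite mulr1.
have excess_ge0 k : true -> 0 <= l k * (#|E :&: P k|%:R - 1).
  by move=> _; rewrite mulr_ge0 // subr_ge0 ler1n card_gt0.
have sum_excess : \sum_k l k * (#|E :&: P k|%:R - 1) = 0.
  apply/le_anti; rewrite sumr_ge0 // andbT.
  under eq_bigr do rewrite mulrBr mulr1.
  by rewrite big_split sumrN /= suml -exch subr_le0 -xE ler_sum.
have excess0 k : l k * (#|E :&: P k|%:R - 1) = 0.
  exact: (psumr_eq0P excess_ge0 sum_excess).
split=> [k lk|i iE xi].
  have /eqP := excess0 k; rewrite mulf_eq0 (negPf lk) subr_eq0 /=.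
  by rewrite -[1]/(1%:R) eqr_nat => /eqP.
have slack0 : \sum_(k | i \in P k) l k = x i.
  apply/eqP; rewrite eq_sym -subr_eq0; apply/eqP.
  apply: (psumr_eq0P (P := [in E])
            (F := fun i => x i - \sum_(k | i \in P k) l k)) => //.
    by move=> j jE; rewrite subr_ge0 leP.
  rewrite big_split sumrN /= exch -/(mass x E) xE; apply/eqP.
  rewrite subr_eq0 eq_sym -subr_eq0; apply/eqP; rewrite -[RHS]sum_excess.
  under [RHS]eq_bigr do rewrite mulrBr mulr1.
  by rewrite big_split sumrN /= suml.
apply/exists_inP; apply: contraNT xi; rewrite negb_exists_in => /forall_inP l0.
rewrite -slack0 big1 // => k iP; apply/eqP; move: (l0 k); rewrite iP.
by case: eqP => // _ /(_ isT).
Qed.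

(** The set through [j] meets [E e] in [j] alone, so these sets are independent. Their differences,
    together with the unit vector at [i], are [#|E e|] independent vectors orthogonal to all members
    avoiding [i]; [unitmx_zero_block] then bounds their number. *)
Lemma card_row_le_column (F : fieldType) m (E : 'I_m -> {set 'I_m})
    (i e : 'I_m) :
  incidence F E \in unitmx -> i \notin E e ->
  (forall j, j \in E e -> exists2 P : {set 'I_m}, j \in P &
     forall e', i \notin E e' -> #|E e' :&: P| = 1%N) ->
  (#|E e| <= #|[set e' | i \in E e']|)%N.
Proof.
move=> unitE iE cover_through.
have [->|[j0 j0E]] := set_0Vmem (E e); first by rewrite cards0.
have /fin_all_exists[p pP] : forall j, exists P : {set 'I_m}, j \in E e ->
    j \in P /\ (forall e', i \notin E e' -> #|E e' :&: P| = 1%N).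
  move=> j; have [/cover_through[P jP PE]|] := boolP (j \in E e).
    by exists P.
  by exists set0.
have in_p j t : j \in E e -> t \in E e -> (t \in p j) = (t == j).
  move=> jE tE; have [jp /(_ e iE)/eqP/cards1P[s Es]] := pP j jE.
  have : j \in E e :&: p j by rewrite inE jE.
  have <- : (t \in E e :&: p j) = (t \in p j) by rewrite inE tE.
  by rewrite Es !inE => /eqP->.
(* The rows of [W * A^T], with [A] the incidence matrix, that come from
   [i] and from [E e] minus [j0] vanish on the members avoiding [i]. *)
pose W : 'M[F]_m := \matrix_(j, t) if j \in E e
  then (t \in p j)%:R - (j != j0)%:R * (t \in p j0)%:R else (t == j)%:R.
(* [W] is triangular for a suitable order: a vector in its left kernel vanishes on [E e] minus [j0],
   then at [j0], then outside [E e]. *)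
have unitW : W \in unitmx.
  rewrite -row_free_unit; apply: inj_row_free => v vW0.
  have coord t : \sum_j v 0 j * W j t = 0.
    by move/matrixP/(_ 0 t): vW0; rewrite !mxE.
  have v_E t : t \in E e -> t != j0 -> v 0 t = 0.
    move=> tE tj0; have := coord t; rewrite (bigD1 t) //= big1 => [|j jt].
      rewrite addr0 mxE tE !in_p // eqxx (negPf tj0) mulr0 subr0 mulr1 //.
    rewrite mxE; case: ifP => jE; last by rewrite eq_sym (negPf jt) mulr0.
    by rewrite !in_p // eq_sym (negPf jt) (negPf tj0) mulr0 subr0 mulr0.
  have v_j0 : v 0 j0 = 0.
    have := coord j0; rewrite (bigD1 j0) //= big1 => [|j jj0].
      by rewrite addr0 mxE j0E in_p // eqxx mul0r subr0 mulr1.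
    rewrite mxE; case: ifP => jE; last by rewrite eq_sym (negPf jj0) mulr0.
    by rewrite v_E // mul0r.
  have {}v_E t : t \in E e -> v 0 t = 0.
    by have [->|] := eqVneq t j0 => //; move=> tj0 /v_E; exact.
  apply/rowP => t; rewrite mxE; have [tE|tE] := boolP (t \in E e).
    exact: v_E.
  have := coord t; rewrite (bigD1 t) //= big1 => [|j jt].
    by rewrite addr0 mxE (negPf tE) eqxx mulr1.
  rewrite mxE; case: ifP => jE; first by rewrite v_E ?mul0r.
  by rewrite eq_sym (negPf jt) mulr0.
have /unitmx_zero_block : W *m (incidence F E)^T \in unitmx.
  by rewrite unitmx_mul unitmx_tr unitW.
move=> /(_ (i |: E e :\ j0) [set e' | i \notin E e']) block.
have : (#|i |: E e :\ j0| + #|[set e' | i \notin E e']| <= m)%N.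
  apply: block => j e'; rewrite !inE => jX ie'; rewrite mxE.
  case/orP: jX => [/eqP->|/andP[jj0 jE]].
    rewrite (bigD1 i) //= big1 => [|t ti]; rewrite !mxE (negPf iE).
      by rewrite (negPf ie') mulr0 addr0.
    by rewrite (negPf ti) mul0r.
  rewrite (eq_bigr (fun t => (t \in E e')%:R * (t \in p j)%:R -
                             (t \in E e')%:R * (t \in p j0)%:R)) => [|t _].
    rewrite sumrB !sum_indicI (pP j jE).2 // (pP j0 j0E).2 // subrr //.
  by rewrite !mxE jE jj0 mul1r mulrBl !(mulrC _ (t \in E e')%:R).
have -> : #|i |: E e :\ j0| = #|E e|.
  by rewrite cardsU1 !inE (negPf iE) andbF (cardsD1 j0 (E e)) j0E.
have -> : [set e' | i \notin E e'] = ~: [set e' | i \in E e'].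
  by apply/setP => e'; rewrite !inE.
by have := cardsC [set e' | i \in E e']; rewrite card_ord; lia.
Qed.

(* Summing [1 / (m - |E_e|)] over the non-incident pairs gives [m], and so does
   summing [1 / (m - d_i)], where [d_i] is the degree of [i]. *)
Lemma card_row_eq_column m (E : 'I_m -> {set 'I_m}) :
  (forall e, #|E e| < m)%N -> (forall i, #|[set e | i \in E e]| < m)%N ->
  (forall i e, i \notin E e -> #|E e| <= #|[set e' | i \in E e']|)%N ->
  forall i e, i \notin E e -> #|E e| = #|[set e' | i \in E e']|.
Proof.
move=> row_lt col_lt row_le i e iE.
pose r e : rat := (m - #|E e|)%:R^-1.
pose c i : rat := (m - #|[set e | i \in E e]|)%:R^-1.
have r_le_c j f : j \notin E f -> r f <= c j.
  move=> jE; rewrite /r /c lef_pV2 ?posrE ?ltr0n ?subn_gt0 //.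
  by rewrite ler_nat leq_sub2l // row_le.
have card_compl (A : {set 'I_m}) : (#|~: A| = m - #|A|)%N.
  by have := cardsC A; rewrite card_ord; lia.
have sum_r : \sum_f \sum_(j | j \notin E f) r f = m%:R.
  rewrite -[X in X%:R]card_ord -sum1_card natr_sum; apply: eq_bigr => f _.
  rewrite sumr_const -[X in r f *+ X](_ : m - #|E f| = _)%N; last first.
    by rewrite -card_compl; apply: eq_card => j; rewrite !inE.
  by rewrite -[LHS]mulr_natl mulfV // pnatr_eq0 subn_eq0 -ltnNge.
have sum_c : \sum_f \sum_(j | j \notin E f) c j = m%:R.
  rewrite (exchange_big_dep predT) //=.
  rewrite -[X in X%:R]card_ord -sum1_card natr_sum; apply: eq_bigr => j _.
  rewrite sumr_const.
  rewrite -[X in c j *+ X](_ : m - #|[set f | j \in E f]| = _)%N; last first.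
    by rewrite -card_compl; apply: eq_card => f; rewrite !inE.
  by rewrite -[LHS]mulr_natl mulfV // pnatr_eq0 subn_eq0 -ltnNge.
have gap_ge0 f : true -> 0 <= \sum_(j | j \notin E f) (c j - r f).
  by move=> _; apply: sumr_ge0 => j jE; rewrite subr_ge0 r_le_c.
have sum_gap : \sum_f \sum_(j | j \notin E f) (c j - r f) = 0.
  under eq_bigr do rewrite sumrB.
  by rewrite sumrB sum_c sum_r subrr.
have gap0 : c i - r e = 0.
  have gap_e := psumr_eq0P gap_ge0 sum_gap (isT : xpredT e).
  apply: (psumr_eq0P _ gap_e iE) => j jE; by rewrite subr_ge0 r_le_c.
(* Both cardinals are below [m], so equal truncated differences force equal cardinals. *)
move/eqP: gap0; rewrite subr_eq0 => /eqP/invr_inj/eqP; rewrite eqr_nat => /eqP.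
by move: (row_lt e) (col_lt i); lia.
Qed.

Lemma no_fractional_vertex (F : realFieldType) m (E : 'I_m.+1 -> {set 'I_m.+1})
    (x : 'I_m.+1 -> F) (P : {set 'I_m.+1}) :
  incidence F E \in unitmx -> (forall i, 0 < x i) -> (forall i, x i < 1) ->
  (forall e, mass x (E e) = 1) ->
  (forall i e, i \notin E e -> #|E e| <= #|[set e' | i \in E e']|)%N ->
  (forall e, E e :&: P != set0) -> ~ #|P|%:R <= mass x setT.
Proof.
move=> unitE x_gt0 x_lt1 xE row_le hitP P_le.
(* The tight system determines its solution, so the indicator of [Q] would be [x], against
   [0 < x < 1]. *)
have no_exact (Q : {set 'I_m.+1}) : (forall e, #|E e :&: Q| = 1%N) -> False.
  move=> EQ; have := mulKmx unitE (\col_i (x i - (i \in Q)%:R)).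
  rewrite (_ : _ *m (\col_ _ _) = 0) ?mulmx0 => [/matrixP/(_ ord0 0)|].
    rewrite !mxE => /esym/eqP; rewrite subr_eq0 => /eqP x0.
    move: (x_gt0 ord0) (x_lt1 ord0); rewrite x0.
    by case: (_ \in _); rewrite ltxx.
  apply/matrixP => e j; rewrite !mxE.
  under eq_bigr do rewrite !mxE mulrBr.
  rewrite sumrB sum_indicI EQ; apply/eqP.
  rewrite subr_eq0 -[eqbRHS](xE e) /mass [eqbRHS]big_mkcond; apply/eqP/eq_bigr => i _.
  by case: (i \in E e); rewrite ?mul1r ?mul0r.
have fullT (A : {set 'I_m.+1}) : (m.+1 <= #|A|)%N -> A = setT.
  by move=> full; apply/eqP; rewrite eqEcard subsetT cardsT card_ord.
have avoid i : exists e, i \notin E e.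
  apply/existsP; rewrite -negb_forall; apply/negP => /forallP iE.
  apply: (no_exact [set i]) => e.
  by rewrite (setIidPr _) ?cards1 // sub1set.
have col_lt i : (#|[set e | i \in E e]| < m.+1)%N.
  have [e] := avoid i; rewrite ltnNge; apply: contra => /fullT iE.
  by have := in_setT e; rewrite -iE inE.
(* A full member would strictly contain another member of mass 1, while [x] is positive. *)
have row_lt e : (#|E e| < m.+1)%N.
  rewrite ltnNge; apply/negP => /fullT EeT; have [f iE] := avoid ord0.
  suff : mass x (E e) > 1 by rewrite xE ltxx.
  rewrite -(xE f) EeT /mass [ltRHS](bigID [in E f]) /=.
  rewrite [X in _ < X + _](eq_bigl [in E f]) => [|j]; last by rewrite inE.
  rewrite ltrDl (bigD1 ord0) ?inE //= ltr_pwDl //.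
  by apply: sumr_ge0 => j _; apply: ltW.
have row_col := card_row_eq_column row_lt col_lt row_le.
(* When all members have size [r], so do all degrees, and double counting gives [r * x(V) = m + 1].
   The [m + 1] intersections with [P] then have total size at most [m + 1] and are nonempty, hence
   are singletons. *)
have [/forallP eq_card_E|] := boolP [forall e, #|E e| == #|E ord0|].
  pose r := #|E ord0|.
  have deg_r i : #|[set e | i \in E e]| = r.
    have [e iE] := avoid i.
    by rewrite -(row_col i e iE); apply/eqP.
  have x_total : r%:R * mass x setT = m.+1%:R.
    transitivity (\sum_e mass x (E e)); last first.
      by rewrite (eq_bigr _ (fun e _ => xE e)) sumr_const card_ord.
    rewrite /mass (exchange_big_dep predT) //= mulr_sumr.
    apply: eq_big => [i|i _]; first by rewrite inE.
    rewrite sumr_const -(deg_r i) mulr_natl; congr (_ *+ _).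
    by apply: eq_card => e; rewrite !inE.
  have P_total : (\sum_e #|E e :&: P| = r * #|P|)%N.
    under eq_bigr do rewrite -sum1_card.
    rewrite (exchange_big_dep [in P]) /= => [|e i _]; last first.
      by rewrite inE => /andP[].
    rewrite mulnC -sum_nat_const; apply: eq_bigr => i iP.
    rewrite -(deg_r i) -sum1dep_card; apply: eq_bigl => e.
    by rewrite inE iP andbT.
  have P_small : (\sum_e #|E e :&: P| <= \sum_(e < m.+1) 1)%N.
    rewrite P_total sum1_card card_ord -(ler_nat F) natrM -x_total.
    by rewrite ler_wpM2l.
  apply: (no_exact P) => e; apply/eqP; rewrite eq_sym.
  have le1 f : xpredT f -> (1 <= #|E f :&: P| ?= iff (1 == #|E f :&: P|))%N.
    by move=> _; apply: leqif_eq; rewrite card_gt0.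
  have [le_sum /esym] := leqif_sum le1.
  by rewrite eqn_leq P_small le_sum => /forall_inP/(_ e isT).
(* Members of different sizes have no common non-member, so they cover [V] and
   [x(V) <= 2]; a [P] with two elements in [E e] would then make them disjoint. *)
rewrite negb_forall => /existsP[f neq_f].
have other e : exists g, #|E e| != #|E g|.
  have [eq_e|] := eqVneq #|E e| #|E ord0|; last by exists ord0.
  by exists f; rewrite eq_e eq_sym.
apply: (no_exact P) => e; apply/eqP.
rewrite eqn_leq card_gt0 hitP andbT leqNgt; apply/negP => P_gt1.
have [g neq_eg] := other e.
have EU : E e :|: E g = setT.
  apply/setP => i; rewrite !inE; apply/negPn; rewrite negb_or; apply/negP.
  move=> /andP[/row_col ie /row_col ig]; by rewrite ie ig eqxx in neq_eg.
have P_ge2 : 2 <= #|P|%:R :> F.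
  by rewrite (ler_nat _ 2) (leq_trans P_gt1) // subset_leq_card // subsetIr.
have EUI : mass x setT + mass x (E e :&: E g) = 2.
  by rewrite -EU massUI !xE.
have EI i : i \in E e -> i \in E g -> False.
  move=> ie ig; have : 0 < mass x (E e :&: E g).
    by apply: (mass_gt0 (i := i)); rewrite ?inE ?ie.
  move: P_le P_ge2 EUI; lra.
have /eqP P2 : #|P| == 2%N.
  rewrite -(eqr_nat F) eq_le P_ge2 (le_trans P_le) // -EUI lerDl.
  by apply: sumr_ge0 => i _; apply: ltW.
have /set0Pn[i /setIP[ig iP]] := hitP g.
have sPE : P \subset E e.
  by apply/setIidPr/eqP; rewrite eqEcard subsetIr P2.
exact: EI (subsetP sPE i iP) ig.
Qed.

Theorem packs_covers_below (F : realFieldType) m (G : {set {set 'I_m}}) :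
  upclosed G -> packs G -> forall x : 'I_m -> F, fractional_cover G x ->
  covers_below G setT x.
Proof.
elim: m G => [|m IH] G upG pG.
  (* Without variables, a member would have mass 0, so [G] is empty and the empty set hits it. *)
  move=> x [x_ge0 x_ge1]; exists unit, (fun=> set0), (fun=> 1); split=> //.
  - by rewrite sumr_const card_unit.
  - by move=> _; apply/hitsP => E /x_ge1; rewrite /mass big1 ?ler10 // => -[].
  - by case.
have IHminor (i : 'I_m.+1) (V : {set 'I_m.+1}) :
    (forall j : 'I_m, lift i j \notin V) ->
    forall y : 'I_m -> F, fractional_cover (minor (lift i) V G) y ->
    covers_below (minor (lift i) V G) setT y.
  move=> liftV; apply: IH; first exact: upclosed_minor.
  by apply: packs_minor => //; exact: lift_inj.
apply: covers_below_from_vertices => [x xG [i xi]|x E xG x_gt0 EG xE unitE].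
  apply: covers_below_contraction xi => //; apply: IHminor => j.
  by rewrite inE eq_sym neq_lift.
have del i : covers_below G [set~ i] x.
  by apply: covers_below_deletion => //; apply: IHminor => j; rewrite inE.
(* If [1 <= x i], the combination obtained by deleting [i] also respects coordinate [i], its total
   weight being 1. *)
have [/existsP[i xi_ge1]|] := boolP [exists i, 1 <= x i].
  have [K [P [l [l_ge0 suml hitP leP]]]] := del i.
  exists K, P, l; split=> // j _; have [->|ji] := eqVneq j i; last first.
    by apply: leP; rewrite !inE.
  apply: le_trans xi_ge1.
  rewrite -suml [leRHS](bigID (fun k => i \in P k)) /= lerDl.
  exact: sumr_ge0.
rewrite negb_exists => /forallP x_lt1.
have [P [S [hitP sSG trivS leS]]] : konig_family G.
  rewrite -(minor_id G); apply: pG => // [i|]; first by rewrite inE.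
  by rewrite minor_id; apply/negP => /xG.2; rewrite /mass big_set0 ler10.
exfalso; apply: (no_fractional_vertex unitE x_gt0 _ xE _ (P := P)) => //.
- by move=> i; rewrite ltNge.
- move=> i e iE; apply: (card_row_le_column unitE iE) => j jE.
  have [K [Q [l [l_ge0 suml hitQ leQ]]]] := del i.
  have tight f : i \notin E f -> (forall k, l k != 0 -> #|E f :&: Q k| = 1%N) /\
      (forall i, i \in E f -> x i != 0 -> exists2 k, l k != 0 & i \in Q k).
    move=> iF; apply: covers_below_tight => // [k|t tE].
      exact: (forall_inP (hitQ k) _ (EG f)).
    by apply: leQ; rewrite !inE; apply: contraNneq iF => <-.
  have [_ /(_ j jE)[|k lk jQ]] := tight e iE; first by rewrite gt_eqF.
  by exists (Q k) => // f /tight[+ _]; apply.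
- by move=> e; exact: (forall_inP hitP _ (EG e)).
(* The members of [S] are disjoint and each has mass at least 1, so [#|P| <= #|S| <= x(V)]. *)
have : mass x (cover S) <= mass x setT by apply: mass_mono => // i; exact: xG.1.
apply: le_trans; rewrite /mass big_trivIset //=.
apply: (@le_trans _ _ #|S|%:R); first by rewrite ler_nat.
rewrite -sum1_card natr_sum; apply: ler_sum => A AS.
by apply: xG.2; exact: (subsetP sSG).
Qed.

(** * Fractional packings by linear duality *)

Lemma farkas_fin (F : realFieldType) (J : finType) n (a : J -> 'rV[F]_n)
    (b : 'rV[F]_n) :
  (exists2 l : J -> F, forall j, 0 <= l j & \sum_j l j *: a j = b) \/
  (exists2 x : 'cV[F]_n, forall j, (a j *m x) 0 0 <= 0 & 0 < (b *m x) 0 0).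
Proof.
have rowA (k : 'I_#|J|) : row k (\matrix_k a (enum_val k)) = a (enum_val k).
  by rewrite rowK.
have [[l l_ge0 lA]|[x Ax bx]] := farkas (\matrix_(k < #|J|) a (enum_val k)) b.
  left; exists (fun j => l 0 (enum_rank j)) => [j|]; first exact: l_ge0.
  rewrite -lA mulmx_sum_row (reindex (@enum_rank J)) /=.
    by apply: eq_bigr => j _; rewrite rowA enum_rankK.
  by apply: onW_bij; exact: enum_rank_bij.
right; exists x => // j.
have := Ax (enum_rank j).
by rewrite -{2}(enum_rankK j) -rowA -row_mul [X in _ -> X <= 0]mxE.
Qed.

(** By Farkas, a failure would produce a fractional cover [y'] with [w . y' < 1]; but [y'] dominates
    a convex combination of hitting sets, each of [w]-mass at least 1. *)
Theorem packs_fractional_packing (F : realFieldType) n (G : {set {set 'I_n}})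
    (w : 'I_n -> F) :
  upclosed G -> packs G -> (forall i, 0 <= w i) ->
  (forall P, hits G P -> 1 <= mass w P) ->
  exists (K : finType) (E : K -> {set 'I_n}) (l : K -> F) (u : 'I_n -> F),
    [/\ forall k, E k \in G, forall k, 0 <= l k, \sum_k l k = 1,
        forall i, 0 <= u i & forall i, w i = \sum_(k | i \in E k) l k + u i].
Proof.
move=> upG pG w_ge0 w_ge1.
pose K : finType := {E : {set 'I_n} | E \in G}.
(* The extra coordinate encodes the normalization of the weights of the members; the unit vectors
   carry the slack [u]. *)
pose a (j : K + 'I_n) : 'rV[F]_(n + 1) :=
  match j with
  | inl E => row_mx (\row_i (i \in sval E)%:R) (const_mx 1)
  | inr i => row_mx (delta_mx 0 i) 0
  end.
have [[l l_ge0 suml]|[x]] := farkas_fin a (row_mx (\row_i w i) (const_mx 1)).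
  exists K, (fun k => sval k), (fun k => l (inl k)), (fun i => l (inr i)).
  split.
  - by move=> k; exact: (svalP k).
  - by [].
  - move/matrixP/(_ 0 (rshift n 0)): suml; rewrite row_mxEr mxE => <-.
    rewrite summxE big_sumType /= [X in _ + X]big1 ?addr0 => [|i _].
      by apply: eq_bigr => k _; rewrite mxE row_mxEr mxE mulr1.
    by rewrite mxE row_mxEr mxE mulr0.
  - by [].
  - move=> i; move/matrixP/(_ 0 (lshift 1 i)): suml; rewrite row_mxEl mxE => <-.
    rewrite summxE big_sumType /=; congr (_ + _).
      rewrite [RHS]big_mkcond; apply: eq_bigr => k _; rewrite mxE row_mxEl mxE.
      by case: ifP; rewrite ?mulr1 ?mulr0.
    rewrite (bigD1 i) //= big1 => [|j ji]; rewrite mxE row_mxEl mxE eqxx /=.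
      by rewrite eqxx mulr1 addr0.
    by rewrite eq_sym (negPf ji) mulr0.
rewrite -[x]vsubmxK; set y := usubmx x; set c := dsubmx x 0 0.
have rowE (v : 'rV[F]_n) (d : 'M[F]_1) :
    (row_mx v d *m col_mx y (dsubmx x)) 0 0 = \sum_i v 0 i * y i 0 + d 0 0 * c.
  by rewrite mul_row_col mxE !mxE big_ord1.
move=> ax_le0; rewrite rowE mxE mul1r => wy.
have y_le0 i : y i 0 <= 0.
  have := ax_le0 (inr i); rewrite rowE mxE mul0r addr0 (bigD1 i) //= big1.
    by rewrite mxE !eqxx mul1r addr0.
  by move=> j ji; rewrite mxE eqxx (negPf ji) mul0r.
have yE E : E \in G -> mass (fun i => y i 0) E + c <= 0.
  move=> EG; have := ax_le0 (inl (exist _ E EG)).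
  rewrite rowE mxE mul1r /mass [X in _ -> X + _ <= _]big_mkcond /=.
  congr (is_true (_ + _ <= _)); apply: eq_bigr => i _.
  by rewrite mxE; case: ifP; rewrite ?mul1r ?mul0r.
have wy_le0 : \sum_i w i * y i 0 <= 0.
  by apply: sumr_le0 => i _; rewrite mulr_ge0_le0.
have wyE : \sum_i (\row_i w i) 0 i * y i 0 = \sum_i w i * y i 0.
  by apply: eq_bigr => i _; rewrite mxE.
rewrite {}wyE in wy.
have c_gt0 : 0 < c by move: wy wy_le0; lra.
(* Dividing the separating vector by [- c] turns its inequalities into those of a fractional
   cover. *)
have [|K' [P [l [l_ge0 suml hitP leP]]]] :=
    packs_covers_below upG pG (x := fun i => - y i 0 / c).
  split=> [i|E EG]; first by rewrite divr_ge0 ?oppr_ge0 ?(ltW c_gt0).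
  rewrite /mass -mulr_suml ler_pdivlMr // mul1r sumrN.
  by have := yE E EG; rewrite /mass; lra.
suff : 1 <= \sum_i w i * (- y i 0 / c).
  have -> : \sum_i w i * (- y i 0 / c) = - (\sum_i w i * y i 0) / c.
    by rewrite -sumrN mulr_suml; apply: eq_bigr => i _; rewrite mulrA mulrN.
  by rewrite ler_pdivlMr // mul1r; move: wy; lra.
apply: (@le_trans _ _ (\sum_i w i * \sum_(k | i \in P k) l k)); last first.
  by apply: ler_sum => i _; rewrite ler_wpM2l ?leP ?inE.
under eq_bigr do rewrite mulr_sumr.
rewrite (exchange_big_dep predT) //= -suml; apply: ler_sum => k _.
rewrite -mulr_suml ler_peMl //; exact: w_ge1.
Qed.

(** * Square-free monomial ideals *)

From mathcomp Require Import mpoly.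
From mathcomp Require Import boolp classical_sets reals convex.
From mathcomp Require Import interval_inference.

Local Open Scope classical_set_scope.
Local Open Scope ring_scope.

Definition chi n (E : {set 'I_n}) : 'X_{1..n} :=
  [multinom (i \in E : nat) | i < n].

Definition msuppvar n (m : 'X_{1..n}) : {set 'I_n} := [set i | (0 < m i)%N]%SET.

Definition supports (K : fieldType) n (I : set {mpoly K[n]}) :
    {set {set 'I_n}} :=
  [set E : {set 'I_n} | `[< I 'X_[chi E] >]]%SET.

Lemma msuppvar_chi n (E : {set 'I_n}) : msuppvar (chi E) = E.
Proof. by apply/setP => i; rewrite inE mnmE; case: (i \in E). Qed.

Lemma chi_msuppvar_le n (m : 'X_{1..n}) : (chi (msuppvar m) <= m)%MM.
Proof. by apply/mnm_lepP => i; rewrite mnmE inE; case: (m i). Qed.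

Lemma squarefree_le_chi n (s m : 'X_{1..n}) :
  squarefree_mnm s -> (s <= m)%MM -> (s <= chi (msuppvar m))%MM.
Proof.
move=> sqf /mnm_lepP le_sm; apply/mnm_lepP => i; rewrite mnmE inE.
by have := le_sm i; have := sqf i; case: (s i) => [|[|]] // _ ->.
Qed.

Lemma monomial_le (K : fieldType) n (J : set {mpoly K[n]}) (s m : 'X_{1..n}) :
  is_ideal J -> J 'X_[s] -> (s <= m)%MM -> J 'X_[m].
Proof.
by move=> Ji Js le_sm; rewrite -(submK le_sm) mpolyXD; apply: idealM.
Qed.

Lemma squarefree_is_ideal (K : fieldType) n (I : set {mpoly K[n]}) :
  squarefree_monomial_ideal I -> is_ideal I.
Proof. by move=> [S _ ->]; exact: ideal_gen_ideal. Qed.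

Lemma mnm_ideal_monomial (K : fieldType) n (S : set 'X_{1..n}) (m : 'X_{1..n}) :
  mnm_ideal K S 'X_[m] <-> exists2 s, S s & (s <= m)%MM.
Proof.
rewrite mnm_idealP msuppX; split=> [|Hm m']; first by apply; rewrite inE.
by rewrite inE => /eqP ->.
Qed.

(** A square-free generator dividing a monomial already divides its square-free part, so membership
    depends on the support only. *)
Lemma squarefree_monomial (K : fieldType) n (I : set {mpoly K[n]})
    (m : 'X_{1..n}) :
  squarefree_monomial_ideal I -> I 'X_[m] <-> msuppvar m \in supports I.
Proof.
move=> sqI; rewrite inE; split=> [|/asboolP Im]; last first.
  apply: monomial_le Im (chi_msuppvar_le m); exact: squarefree_is_ideal.
case: sqI => S Ssqf -> /mnm_ideal_monomial[s Ss le_sm].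
apply/asboolP/mnm_ideal_monomial; exists s => //.
by apply: squarefree_le_chi => //; exact: Ssqf.
Qed.

Lemma upclosed_supports (K : fieldType) n (I : set {mpoly K[n]}) :
  squarefree_monomial_ideal I -> upclosed (supports I).
Proof.
move=> /squarefree_is_ideal Ii E E'; rewrite [E \in _]inE [E' \in _]inE.
move=> /asboolP IE /fintype.subsetP sEE'; apply/asboolP.
apply: (monomial_le Ii IE); apply/mnm_lepP => i; rewrite !mnmE.
by case: (boolP (i \in E)) => // /sEE' ->.
Qed.

Lemma mpoly_in_squarefree (K : fieldType) n (I : set {mpoly K[n]}) f m :
  squarefree_monomial_ideal I -> I f -> m \in msupp f -> I 'X_[m].
Proof.
by move=> [S _ ->] /mnm_idealP/(_ m) Hf /Hf Hm; apply/mnm_ideal_monomial.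
Qed.

Lemma mem_prime_components (K : fieldType) n (I : set {mpoly K[n]}) f :
  squarefree_monomial_ideal I ->
  I f <-> forall A, A \in prime_components I -> var_ideal K A f.
Proof.
move=> /prime_componentsP[/seteqP[sub sup] _].
by split=> [/sub If A DA|If]; [exact: If | apply: sup => A; exact: If].
Qed.

Lemma prime_component_hits (K : fieldType) n (I : set {mpoly K[n]}) A :
  squarefree_monomial_ideal I -> A \in prime_components I ->
  hits (supports I) A.
Proof.
move=> sqI DA; apply/hitsP => E; rewrite inE => /asboolP.
move=> /(mem_prime_components _ sqI)/(_ A DA)/var_idealP/(_ (chi E)).
rewrite msuppX inE eqxx => /(_ isT)[i iA]; rewrite mnmE lt0b => iE.
by exists i.
Qed.

(** If no component lay inside [P], the product of the variables outside [P] would belong to every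
    component, hence to [I], and [P] would miss its support. *)
Lemma hits_prime_component (K : fieldType) n (I : set {mpoly K[n]}) P :
  squarefree_monomial_ideal I -> hits (supports I) P ->
  exists2 A, A \in prime_components I & A \subset P.
Proof.
move=> sqI hitP; apply: contrapT => noA.
have : (~: P)%SET \in supports I.
  rewrite inE; apply/asboolP/mem_prime_components => // A DA.
  rewrite (_ : chi _ = [multinom (i \notin P : nat) | i < n]).
    by apply/var_ideal_setC => AP; apply: noA; exists A.
  by apply/mnmP => i; rewrite !mnmE inE.
by move/(hitsP _ _ hitP) => [i]; rewrite inE => /negP.
Qed.

Lemma height_component (K : fieldType) n (I : set {mpoly K[n]}) :
  squarefree_monomial_ideal I -> I <> setT ->
  exists2 A, A \in prime_components I & (#|A| <= height I)%N.
Proof.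
move=> sqI IT.
have [A0 DA0] : exists A, A \in prime_components I.
  apply: contrapT => noA; apply: IT; apply/seteqP; split=> // f _.
  by apply/mem_prime_components => // A DA; case: noA; exists A.
case: (arg_minnP (fun A : {set 'I_n} => #|A|) DA0) => A DA minA; exists A => //.
(* The neutral value [n] is harmless, as [#|A| <= n]. *)
rewrite /height; elim/big_ind: _ => [|p q|B /minA //].
  by have := max_card (mem A); rewrite card_ord.
by rewrite leq_min => -> ->.
Qed.

(** * Setting variables to 0 and 1 *)

Definition subst01 (K : fieldType) n (V0 V1 : {set 'I_n}) :
    n.-tuple {mpoly K[n]} :=
  [tuple if i \in V0 then 0 else if i \in V1 then 1 else 'X_i | i < n].

Lemma comp_subst01_mnm (K : fieldType) n (V0 V1 : {set 'I_n})
    (m : 'X_{1..n}) :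
  'X_[m] \mPo subst01 K V0 V1 =
    if [disjoint msuppvar m & V0]%B
    then 'X_[[multinom (if i \in V1 then 0 else m i)%N | i < n]] else 0.
Proof.
rewrite comp_mpolyX; case: ifP => [dis|/negbT].
  rewrite mpolyXE_id; apply: eq_bigr => i _; rewrite tnth_mktuple mnmE.
  case: ifP => iV0.
    have : i \notin msuppvar m by rewrite (disjointFl dis).
    rewrite inE -eqn0Ngt => /eqP ->.
    by case: ifP; rewrite !expr0.
  by case: ifP; rewrite ?expr1n ?expr0.
rewrite -setI_eq0 => /set0Pn[i]; rewrite !inE => /andP[mi iV0].
apply/eqP; rewrite prodf_seq_eq0; apply/hasP; exists i.
  exact: mem_index_enum.
by rewrite /= tnth_mktuple iV0 expf_eq0 mi eqxx.
Qed.

Definition specialized_supports (K : fieldType) n (I : set {mpoly K[n]})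
    (V0 V1 : {set 'I_n}) : set {set 'I_n} :=
  [set F : {set 'I_n} |
    [disjoint F & V0]%B /\ (F :|: V1)%SET \in supports I].

(** The substitution kills a monomial or erases its variables in [V1]; the square-free part of what
    survives has its support in the given family. *)
Lemma specialize_mnm_ideal (K : fieldType) n (I : set {mpoly K[n]})
    (V0 V1 : {set 'I_n}) :
  squarefree_monomial_ideal I -> [disjoint V0 & V1]%B ->
  specialize V0 V1 I = mnm_ideal K [set chi F | F in specialized_supports I V0 V1].
Proof.
move=> sqI V01.
apply/seteqP; split.
  apply: smallest_sub => [|_ [f If <-]]; first exact: ideal_gen_ideal.
  rewrite comp_mpolyEX big_seq.
  have Ji := ideal_gen_ideal [set ('X_[m] : {mpoly K[n]}) |
    m in [set chi F | F in specialized_supports I V0 V1]].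
  apply: big_ind => [|g h|m mf]; [exact: (ideal0 Ji)|exact: (idealD Ji)|].
  rewrite -mul_mpolyC; apply: (idealM Ji); rewrite comp_subst01_mnm.
  case: ifP => [dis|_]; last exact: (ideal0 Ji).
  apply/mnm_ideal_monomial; exists (chi (msuppvar m :\: V1)).
    exists (msuppvar m :\: V1)%SET => //; split.
      by apply: disjointWl dis; exact: subsetDl.
    apply: (upclosed_supports sqI (E := msuppvar m)).
      by apply/squarefree_monomial => //; exact: mpoly_in_squarefree If mf.
    by apply/fintype.subsetP => i; rewrite !inE => ->; case: (i \in V1).
  by apply/mnm_lepP => i; rewrite !mnmE !inE; case: (i \in V1); case: (m i).
apply: smallest_sub => [|_ [_ [F [dis FG] <-] <-]].
  exact: ideal_gen_ideal.
have Ji : is_ideal (specialize V0 V1 I) by exact: ideal_gen_ideal.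
(* The exponent of the image of the monomial with support [F :|: V1]; it divides [chi F]. *)
pose s :=
  [multinom (if i \in V1 then 0 else chi (F :|: V1)%SET i)%N | i < n].
apply: (monomial_le (s := s)) => //; last first.
  by apply/mnm_lepP => i; rewrite !mnmE !inE; case: (i \in V1); case: (i \in F).
apply: sub_gen_smallest; exists 'X_[chi (F :|: V1)%SET].
  by move: FG; rewrite inE => /asboolP.
rewrite -/(subst01 K V0 V1) comp_subst01_mnm msuppvar_chi ifT //.
by rewrite -setI_eq0 finset.setIUl finset.setU_eq0 !setI_eq0 dis disjoint_sym.
Qed.

Lemma specialize_squarefree (K : fieldType) n (I : set {mpoly K[n]})
    (V0 V1 : {set 'I_n}) :
  squarefree_monomial_ideal I -> [disjoint V0 & V1]%B ->
  squarefree_monomial_ideal (specialize V0 V1 I).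
Proof.
move=> sqI V01; rewrite specialize_mnm_ideal //; eexists; last by [].
by move=> _ [F _ <-] i; rewrite mnmE; case: (i \in F).
Qed.

(** The specialization stays in the ring in all the variables, so those of [V0] may occur in [E] but
    cannot help. *)
Lemma supports_specialize (K : fieldType) n (I : set {mpoly K[n]})
    (V0 V1 E : {set 'I_n}) :
  squarefree_monomial_ideal I -> [disjoint V0 & V1]%B ->
  (E \in supports (specialize V0 V1 I)) =
    ((E :\: V0) :|: V1 \in supports I)%SET.
Proof.
move=> sqI V01; rewrite [LHS]inE specialize_mnm_ideal //; apply/asboolP/idP.
  move/mnm_ideal_monomial => [_ [F [dis FG] <-] /mnm_lepP leF].
  apply: (upclosed_supports sqI FG); apply/fintype.subsetP => i; rewrite !inE.
  case: (i \in V1); rewrite ?orbT // !orbF => iF; rewrite (disjointFr dis iF) /=.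
  by have := leF i; rewrite !mnmE iF; case: (i \in E).
move=> EG; apply/mnm_ideal_monomial; exists (chi (E :\: V0)).
  exists (E :\: V0)%SET => //; split=> //.
  rewrite -setI_eq0; apply/eqP/setP => i; rewrite !inE.
  by case: (i \in V0); rewrite ?andbF.
by apply/mnm_lepP => i; rewrite !mnmE !inE; case: (i \in V0); case: (i \in E).
Qed.

(** * Polyhedra *)

(** A minor comes from the specialization sending [V1] to 1 and everything outside [V1] and the
    range of [f] to 0. Coprime monomials pull back to disjoint members, and a component of least
    size to a hitting set. *)
Lemma packing_packs (K : fieldType) n (I : set {mpoly K[n]}) :
  squarefree_monomial_ideal I -> packing_property I -> packs (supports I).
Proof.
move=> sqI packI m f V1 f_inj fV1 minor0.
pose V0 := (~: ((f @: [set: 'I_m]%SET) :|: V1))%SET.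
have V01 : [disjoint V0 & V1]%B.
  rewrite -setI_eq0; apply/eqP/setP => i; rewrite !inE.
  by case: (i \in V1); rewrite ?orbT ?andbF.
have fV0 i : f i \notin V0 by rewrite !inE imset_f ?inE.
set J := specialize V0 V1 I.
have sqJ : squarefree_monomial_ideal J by exact: specialize_squarefree.
have suppJ E : (E \in supports J) = (f @^-1: E \in minor f V1 (supports I)).
  rewrite supports_specialize // [RHS]inE; congr (_ \in supports I).
  apply/setP => i; rewrite !inE.
  have [//|iV1] := boolP (i \in V1); rewrite ?orbT // !orbF negbK.
  apply/andP/imsetP => [[/imsetP[j _ ->] jE]|[j jE ->]].
    by exists j; rewrite // inE.
  by rewrite imset_f ?inE //; move: jE; rewrite inE.
have JT : J <> setT.
  move=> JT; move: minor0; rewrite -(preimset0 f) -suppJ inE; case/negP.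
  by apply/asboolP; rewrite JT.
have suppJf (E : {set 'I_m}) :
    E \in minor f V1 (supports I) -> (f @: E)%SET \in supports J.
  rewrite suppJ (_ : f @^-1: (f @: E) = E)%SET //.
  by apply/setP => i; rewrite inE mem_imset.
(* The zero ideal contains no monomial, so the minor is empty. *)
have [J0|//|[s [s_uniq s_size sJ s_cop]]] := packI V0 V1 V01.
  exists finset.set0, finset.set0; split; rewrite ?cards0 ?finset.sub0set //.
    apply/hitsP => E /suppJf; rewrite inE => /asboolP; rewrite /J J0 => X0.
    have := msuppX K (chi (f @: E)%SET).
    by rewrite [X in msupp X]X0 msupp0.
  by apply/finset.trivIsetP => A; rewrite inE.
have [A DA leA] := height_component sqJ JT.
pose edge (d : 'X_{1..n}) := (f @^-1: msuppvar d)%SET.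
have edge_minor d : d \in s -> edge d \in minor f V1 (supports I).
  by move=> /sJ; rewrite -suppJ => /squarefree_monomial; exact.
have edge_disjoint d d' : d \in s -> d' \in s -> d != d' ->
    [disjoint edge d & edge d']%B.
  move=> ds d's dd'; rewrite -setI_eq0; apply/eqP/setP => i; rewrite !inE.
  by have [->|->] := s_cop d d' ds d's dd' (f i); rewrite ?andbF.
have edge_neq0 d : d \in s -> edge d != finset.set0.
  by move=> /edge_minor; apply: contraTneq => ->.
exists (f @^-1: A)%SET, [set E in map edge s]%SET; split.
- apply/hitsP => E /suppJf /(hitsP _ _ (prime_component_hits sqJ DA)).
  by move=> [_ /imsetP[i iE ->] iA]; exists i => //; rewrite inE.
- by apply/fintype.subsetP => E; rewrite inE => /mapP[d /edge_minor dm ->].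
- apply/finset.trivIsetP => E E'; rewrite !inE.
  move=> /mapP[d ds ->] /mapP[d' d's ->] neq.
  by apply: edge_disjoint => //; apply: contraNneq neq => ->.
(* The pulled-back supports are nonempty and pairwise disjoint, so distinct monomials give distinct
   members. *)
- have -> : #|[set E in map edge s]%SET| = height J.
    rewrite cardsE; transitivity (size (map edge s)); last by rewrite size_map.
    apply/card_uniqP; rewrite map_inj_in_uniq // => d d' ds d's eq_edge.
    apply/eqP/negP => /negP/(edge_disjoint _ _ ds d's).
    by rewrite eq_edge -setI_eq0 finset.setIid (negPf (edge_neq0 _ d's)).
  apply: leq_trans leA; rewrite -(card_imset _ f_inj) subset_leq_card //.
  by apply/fintype.subsetP => _ /imsetP[i + ->]; rewrite inE.
Qed.

(** * Convex combinations and Newton polyhedra *)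

Lemma convex_set_conv (R : realType) (M : lmodType R)
    (C : set (convex_lmodType M)) (a b : R) (x y : M) :
  convex_set C -> C x -> C y -> 0 <= a -> 0 <= b -> a + b = 1 ->
  C (a *: x + b *: y).
Proof.
move=> convC Cx Cy a_ge0 b_ge0 ab1.
have a_le1 : a <= 1 by rewrite -ab1 lerDl.
have := convC x y (Itv01 a_ge0 a_le1); rewrite !inE => /(_ Cx Cy).
by have -> : b = 1 - a by rewrite -ab1 addrC addKr.
Qed.

(** Induction on the list of indices with normalized partial sums; a tail of total weight 0
    contributes nothing and is treated apart. *)
Lemma convex_set_sum (R : realType) (M : lmodType R)
    (C : set (convex_lmodType M)) (K : finType) (l : K -> R) (v : K -> M) :
  convex_set C -> (forall k, 0 <= l k) -> \sum_k l k = 1 ->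
  (forall k, C (v k)) ->
  C (\sum_k l k *: v k).
Proof.
move=> convC l_ge0 suml Cv.
suff H (r : seq K) : 0 < \sum_(k <- r) l k ->
    C ((\sum_(k <- r) l k)^-1 *: \sum_(k <- r) l k *: v k).
  by have := H (index_enum K); rewrite suml invr1 scale1r; apply; exact: ltr01.
elim: r => [|k r IH]; first by rewrite big_nil ltxx.
rewrite !big_cons => sum_gt0.
have : 0 <= \sum_(k <- r) l k by exact: sumr_ge0.
rewrite le_eqVlt => /orP[/eqP sum0|r_gt0].
  have l0 j : j \in r -> l j = 0.
    move=> jr; apply/eqP; move/esym/eqP: sum0.
    by rewrite psumr_eq0 // => /allP/(_ j jr).
  rewrite -sum0 addr0 in sum_gt0 *.
  rewrite big_seq big1 => [|j /l0 ->]; last by rewrite scale0r.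
  by rewrite addr0 scalerA mulVf ?gt_eqF // scale1r.
set t := \sum_(j <- r) l j in IH r_gt0 sum_gt0 *.
have -> : (l k + t)^-1 *: (l k *: v k + \sum_(j <- r) l j *: v j) =
    (l k / (l k + t)) *: v k +
    (t / (l k + t)) *: (t^-1 *: \sum_(j <- r) l j *: v j).
  rewrite scalerDr !scalerA mulrC; congr (_ + _ *: _).
  by rewrite mulrAC divff ?mul1r // gt_eqF.
apply: convex_set_conv => //; first exact: IH.
- by rewrite divr_ge0 // ltW.
- by rewrite divr_ge0 // ltW.
- by rewrite -mulrDl divff // gt_eqF.
Qed.

Lemma newton_polyhedron_convex (R : realType) (K : fieldType) n
    (I : set {mpoly K[n]}) : convex_set (newton_polyhedron R I).
Proof.
move=> x y t; rewrite !inE => Nx Ny C [convC subC].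
by have := convC x y t; rewrite !inE; apply; [exact: Nx | exact: Ny].
Qed.

Lemma mem_newton_polyhedron (R : realType) (K : fieldType) n
    (I : set {mpoly K[n]}) m :
  I 'X_[m] -> newton_polyhedron R I (\row_i (m i)%:R).
Proof. by move=> Im; apply: sub_gen_smallest; exists m. Qed.

(** Absorbs the real slack [u] of a fractional packing, although the hull is generated by lattice
    points only. *)
Lemma newton_polyhedron_shift (R : realType) (K : fieldType) n
    (I : set {mpoly K[n]}) m (u : 'I_n -> R) :
  is_ideal I -> I 'X_[m] -> (forall i, 0 <= u i) ->
  newton_polyhedron R I (\row_i ((m i)%:R + u i)).
Proof.
move=> Ii Im u_ge0.
pose N := (Num.bound (\sum_i u i)).+1.
have sum_lt : \sum_i u i <= N%:R.
  apply: le_trans (ltW (archi_boundP _)) _; first exact: sumr_ge0.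
  by rewrite ler_nat.
have N_gt0 : 0 < N%:R :> R by rewrite ltr0n.
(* [m + u] is a convex combination of [m] and of the [m + N e_i]. *)
pose l (j : option 'I_n) : R :=
  if j is Some i then u i / N%:R else 1 - (\sum_i u i) / N%:R.
pose d (j : option 'I_n) : 'X_{1..n} :=
  if j is Some i then (m + U_(i) *+ N)%MM else m.
have sum_option (V : nmodType) (F : option 'I_n -> V) :
    \sum_j F j = F None + \sum_i F (Some i).
  rewrite (bigD1 None) //= (reindex_omap Some id) => [|[]] //=.
  by congr (_ + _); apply: eq_bigl => i; rewrite eqxx.
have suml : \sum_j l j = 1 by rewrite sum_option /= -mulr_suml subrK.
have -> : \row_i ((m i)%:R + u i) =
    \sum_j l j *: (\row_i (d j i)%:R) :> 'rV[R]_n.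
  apply/rowP => i; rewrite summxE mxE sum_option !mxE.
  under eq_bigr => j _ do rewrite !mxE mnmDE mulmnE mnm1E natrD mulrDr.
  rewrite big_split /= -mulr_suml -mulr_suml addrA -mulrDl subrK mul1r.
  rewrite (bigD1 i) //= big1 => [|j ji]; last by rewrite (negPf ji) mul0n mulr0.
  by rewrite eqxx mul1n addr0 divfK // gt_eqF.
apply: convex_set_sum => //; first exact: newton_polyhedron_convex.
  case=> [i|] /=; first by rewrite divr_ge0.
  by rewrite subr_ge0 ler_pdivrMr // mul1r.
case=> [i|]; apply: mem_newton_polyhedron => //=.
by apply: (monomial_le Ii Im); apply/mnm_lepP => j; rewrite mnmDE leq_addr.
Qed.

Lemma newton_polyhedron_mono (R : realType) (K : fieldType) n
    (I J : set {mpoly K[n]}) :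
  I `<=` J -> newton_polyhedron R I `<=` newton_polyhedron R J.
Proof.
move=> sIJ w Nw C [convC subC]; apply: Nw; split=> // _ [m Im <-].
by apply: subC; exists m => //; exact: sIJ.
Qed.

Lemma newton_polyhedron_var_ideal (R : realType) (K : fieldType) n
    (A : {set 'I_n}) (w : 'rV[R]_n) : newton_polyhedron R (var_ideal K A) w ->
  (forall i, 0 <= w 0 i) /\ 1 <= mass (w 0) A.
Proof.
suff sub : newton_polyhedron R (var_ideal K A) `<=`
    [set w : 'rV[R]_n | (forall i, 0 <= w 0 i) /\ 1 <= mass (w 0) A].
  exact: sub.
apply: smallest_sub => [x y t|_ [m Am <-]].
  rewrite !inE /= => -[x_ge0 xA] [y_ge0 yA].
  have a_ge0 : 0 <= t%:num by []; have a_le1 : t%:num <= 1 by [].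
  have b_ge0 : 0 <= 1 - t%:num by rewrite subr_ge0.
  set a := t%:num in a_ge0 a_le1 b_ge0.
  have convE : conv t x y = a *: x + (1 - a) *: y by [].
  rewrite convE; split=> [i|]; first by rewrite !mxE addr_ge0 ?mulr_ge0.
  rewrite /mass; under eq_bigr do rewrite !mxE.
  rewrite big_split /= -!mulr_sumr -!/(mass _ _).
  have := lerD (ler_wpM2l a_ge0 xA) (ler_wpM2l b_ge0 yA).
  by rewrite !mulr1 addrCA subrr addr0.
split=> [i|]; first by rewrite mxE ler0n.
move/var_idealP/(_ m): Am; rewrite msuppX inE eqxx => /(_ isT)[i iA mi].
rewrite /mass (bigD1 i) //= mxE (@le_trans _ _ (m i)%:R) ?ler1n // lerDl.
by apply: sumr_ge0 => j _; rewrite mxE ler0n.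
Qed.

Theorem theorem4p1 (R : realType) (K : fieldType) (n : nat)
    (I : set {mpoly K[n]}) :
  squarefree_monomial_ideal I -> I <> [set 0] -> I <> setT ->
  packing_property I ->
  symbolic_polyhedron R I = newton_polyhedron R I.
Proof.
move=> sqI _ IT packI; apply/seteqP; split=> [w SPw|w NPw A DA]; last first.
  apply: newton_polyhedron_mono NPw => f If.
  exact: (mem_prime_components f sqI).1.
(* A proper ideal has some component, from which [w >= 0] follows. *)
have [A0 DA0 _] := height_component sqI IT.
have w_ge0 := (newton_polyhedron_var_ideal (SPw A0 DA0)).1.
have w_ge1 P : hits (supports I) P -> 1 <= mass (w 0) P.
  move=> /(hits_prime_component sqI)[A DA sAP].
  apply: le_trans (newton_polyhedron_var_ideal (SPw A DA)).2 _.
  exact: mass_mono.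
have [L [E [l [u [EI l_ge0 suml u_ge0 wE]]]]] :=
  packs_fractional_packing (upclosed_supports sqI) (packing_packs sqI packI)
    w_ge0 w_ge1.
(* As the weights sum to 1, the slack [u] can be added to every term, which makes each one a shifted
   exponent of [I]. *)
have -> : w = \sum_k l k *: \row_i ((chi (E k) i)%:R + u i).
  apply/rowP => i; rewrite wE summxE.
  under [RHS]eq_bigr do rewrite !mxE mnmE mulrDr.
  rewrite big_split /= -mulr_suml suml mul1r; congr (_ + _).
  rewrite [LHS]big_mkcond; apply: eq_bigr => k _.
  by case: ifP; rewrite ?mulr1 ?mulr0.
apply: convex_set_sum => // [|k]; first exact: newton_polyhedron_convex.
apply: newton_polyhedron_shift => //; first exact: squarefree_is_ideal.
by have := EI k; rewrite inE => /asboolP.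
Qed.
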